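(* For all integers $n\geq 0$ and $k\geq 0$, \begin{align*} &\overline{p}(4^k(16n+14))\equiv 0 \pmod{16},\\ &\overline{p}(4^k(72n+69))\equiv 0 \pmod{32},\\ &\overline{p}(4^k(8n+7))\equiv 0 \pmod{64}. \end{align*}
   Context: An overpartition of a nonnegative integer $n$ is a partition of $n$ in which the first occurrence of each distinct part may be overlined. $\overline{p}(n)$ denotes the number of overpartitions of $n$ (with $\overline{p}(0)=1$); for example $\overline{p}(3)=8$. Its generating function is $\sum_{n\ge 0}\overline{p}(n)q^n=\prod_{m\ge 1}\frac{1+q^m}{1-q^m}$. *)

(* Defs.v *)
From mathcomp Require Import all_boot.

Set Implicit Arguments.
Unset Strict Implicit.
Unset Printing Implicit Defensive.

(* An overpartition is written as the nonincreasing sequence of its parts; the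
   pair (a, b) is a part of size a, overlined iff b = true. *)
Definition is_overpartition (n : nat) (s : seq (nat * bool)) : bool :=
  let parts := unzip1 s in
  let marks := unzip2 s in
  [&& sorted geq parts,
      all (leq 1) parts,
      sumn parts == n
    & all (fun i => nth false marks i ==> (nth 0 parts i \notin take i parts))
          (iota 0 (size s))].

Definition forget_bounds (n : nat) (s : n.-bseq ('I_n.+1 * bool)) :
    seq (nat * bool) :=
  [seq (nat_of_ord x.1, x.2) | x <- s].

(* Number of overpartitions of n. The sequences range over the finite type of
   those with at most n parts, all of size at most n; by bounded_overpartition
   below this omits no overpartition of n. *)
Definition overp (n : nat) : nat :=
  #|[set s : n.-bseq ('I_n.+1 * bool) | is_overpartition n (forget_bounds s)]|.

Lemma forget_bounds_inj (n : nat) : injective (@forget_bounds n).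
Proof.
move=> s t /inj_map eq_st; apply/val_inj/eq_st => -[i b] [j c] /= [].
by move=> /val_inj -> ->.
Qed.

Lemma bounded_overpartition (n : nat) (s : seq (nat * bool)) :
  is_overpartition n s ->
  exists t : n.-bseq ('I_n.+1 * bool), forget_bounds t = s.
Proof.
case/and4P=> _ pos /eqP sum_s _.
have [szs les] : size s <= n /\ all (fun x => x.1 <= n) s.
  elim: s n pos sum_s => [|[a b] s IHs] n //= /andP[a_gt0 pos] <-.
  have [szs les] := IHs _ pos erefl; split.
    by rewrite -add1n leq_add.
  rewrite leq_addr; apply/allP => x /(allP les) lex.
  exact: leq_trans lex (leq_addl _ _).
have szt : size [seq (inord x.1 : 'I_n.+1, x.2) | x <- s] <= n by rewrite size_map.
exists (Bseq szt); rewrite /forget_bounds /= -map_comp -[RHS]map_id.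
apply/eq_in_map => -[a b] /(allP les) /= le_an.
by rewrite inordK.
Qed.

(* Main.v *)
Require Import Defs.
From mathcomp Require Import all_boot all_algebra zify ring.

(** Let theta = sum_(a >= 1) (-1)^a q^(a^2).  Gauss's identity
    prod_(m >= 1) (1 - q^m) / (1 + q^m) = 1 + 2 theta says that the generating
    function of overpartitions is 1 / (1 + 2 theta).  Expanding the geometric
    series up to the power J gives ([overp_theta])

      overp n = sum_(j < J) (-2)^j [q^n] theta^j   modulo 2^J,

    and [q^n] theta^j is, up to the sign (-1)^n, the number of ordered
    representations of n as a sum of j positive squares.  So each congruence
    only asks for some 2-divisibility of these numbers for j <= 5.

    Modulo 2 a square of a sum is the sum of the squares.  Hence theta^2 is
    congruent to sum_a q^(2 a^2) modulo 2, theta^4 to the square of that series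
    modulo 4, theta^3 to theta sum_a q^(2 a^2) and theta^5 to
    theta sum_a q^(4 a^2) modulo 2.  All these coefficients vanish at the
    numbers n in question because n has no representation by the corresponding
    quadratic form, which follows from congruences modulo a power of 2 or modulo
    9 and a descent through the factor 4^k.

    This leaves one point: for n = 4^k (72 m + 69) the number of
    representations by three positive squares is a multiple of 4
    ([three_squares_dvd4]).  Here n = 6 modulo 9, so no entry of a solution is
    divisible by 3.  Giving each entry the sign that makes it 1 modulo 3 turns
    a solution into a vector (x, y, z) with x + y + z = 3 s and 3 | s, and the
    reflection in the plane orthogonal to (1, 1, 1) sends it to the integral
    solution (x - 2 s, y - 2 s, z - 2 s) with the same signs.  Here s is not 0,
    since otherwise n = 2 (x^2 + x y + y^2), whose 2-adic valuation is odd; and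
    no two entries agree, since n is not of the form 2 a^2 + b^2.  So the
    reflection and the exchange of the first two entries generate a group of
    order 4 acting freely on the solutions.

    Gauss's identity is obtained by the method of Shanks: the product of
    prod_(i <= n) (1 + q^i) with the partial sum of 1 + 2 theta up to q^(n^2)
    equals a polynomial in q and x, evaluated at x = q^(n+1), whose value at
    x = 0 is prod_(i <= n) (1 - q^i) ([shanks_shift], [shanks_gauss]). *)

Set Implicit Arguments.
Unset Strict Implicit.
Unset Printing Implicit Defensive.

(** * Counting overpartitions *)

(** Successive parts (a, b), (c, d) of an overpartition: the part decreases, or
    it is repeated and the repetition carries no overline. *)
Definition ovstep (x y : nat * bool) : bool :=
  (y.1 < x.1) || (y.1 == x.1) && ~~ y.2.

(** The overpartitions of n with parts at most m in which m is not overlined.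
    Excluding the overlined m makes the set closed under prefixing a plain m, so
    it splits by its first part: plain m.+1, overlined m, or neither.  The fuel
    f is enough as soon as m + n < f. *)
Fixpoint ovs (f m n : nat) : seq (seq (nat * bool)) :=
  if f is f'.+1 then
    if m is m'.+1 then
      ovs f' m' n
      ++ (if 0 < m' <= n then [seq (m', true) :: s | s <- ovs f' m' (n - m')]
          else [::])
      ++ (if m <= n then [seq (m, false) :: s | s <- ovs f' m (n - m)]
          else [::])
    else if n == 0 then [:: [::]] else [::]
  else [::].

Lemma ovsS f m n :
  ovs f.+1 m.+1 n =
  ovs f m n
  ++ (if 0 < m <= n then [seq (m, true) :: s | s <- ovs f m (n - m)] else [::])
  ++ (if m < n then [seq (m.+1, false) :: s | s <- ovs f m.+1 (n - m.+1)]
      else [::]).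
Proof. by []. Qed.

Lemma mem_map_cons (T : eqType) (x y : T) (s : seq T) (L : seq (seq T)) :
  (x :: s \in [seq y :: t | t <- L]) = (x == y) && (s \in L).
Proof.
apply/mapP/andP => [[t tL [-> ->]] | [/eqP -> sL]]; first by rewrite eqxx.
by exists s.
Qed.

Lemma nil_map_cons (T : eqType) (y : T) (L : seq (seq T)) :
  ([::] \in [seq y :: t | t <- L]) = false.
Proof. by apply/mapP => -[]. Qed.

Lemma path_ovstep_mark a b s : path ovstep (a, b) s = path ovstep (a, false) s.
Proof. by case: s. Qed.

(** The sequence starts below a fictitious plain part m. *)
Definition bounded_ov (m n : nat) (s : seq (nat * bool)) : bool :=
  [&& path ovstep (m, false) s, all (fun x => 0 < x.1) s
    & sumn (unzip1 s) == n].

Lemma mem_ovs f m n s : m + n < f -> (s \in ovs f m n) = bounded_ov m n s.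
Proof.
elim: f m n s => [|f IHf] [|m] n s //= lt_mnf.
  rewrite /bounded_ov; case: s => [|[[|a] b] s] /=; case: n lt_mnf => //=;
  by rewrite andbF.
rewrite !mem_cat IHf; last lia.
case: s => [|[a b] s].
  rewrite /bounded_ov /=; case: ifP => _; case: ifP => _;
  by rewrite ?nil_map_cons ?in_nil ?orbF.
have -> : ((a, b) :: s \in if 0 < m <= n
    then [seq (m, true) :: s | s <- ovs f m (n - m)] else [::])
    = [&& 0 < m <= n, (a, b) == (m, true) & bounded_ov m (n - m) s].
  by case: ifP => // /andP[m0 mn]; rewrite mem_map_cons IHf //; lia.
have -> : ((a, b) :: s \in if m < n
    then [seq (m.+1, false) :: s | s <- ovs f m.+1 (n - m.+1)] else [::])
    = [&& m < n, (a, b) == (m.+1, false) & bounded_ov m.+1 (n - m.+1) s].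
  by case: ifP => // mn; rewrite mem_map_cons IHf //; lia.
rewrite /bounded_ov /= !(path_ovstep_mark a b) /ovstep /= !xpair_eqE.
case: (a =P m) => [->|am]; case: (a =P m.+1) => [am1|am1]; subst => //=; try lia;
 case: b => //=; case: (path _ _ _) => //=; case: (all _ _) => //=; lia.
Qed.

Lemma uniq_ovs f m n : m + n < f -> uniq (ovs f m n).
Proof.
elim: f m n => [|f IHf] [|m] n //= lt_mnf; first by case: eqP.
have inj_cons (y : nat * bool) : injective (cons y) by move=> s t [].
have lt_mn : m + n < f by lia.
rewrite !cat_uniq IHf //=; apply/and4P; split.
- apply/hasPn => s; rewrite mem_cat /= mem_ovs // => /orP[]; case: ifP => //;
    move=> _ /mapP[t _ ->]; rewrite /bounded_ov /= /ovstep /=; lia.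
- by case: ifP => // ?; rewrite map_inj_uniq // IHf //; lia.
- apply/hasPn => s /=; case: ifP => // _ /mapP[t _ ->].
  by case: ifP; rewrite // mem_map_cons xpair_eqE andbF.
- by case: ifP => // ?; rewrite map_inj_uniq // IHf //; lia.
Qed.

Definition ovcount (m n : nat) : nat := size (ovs (m + n).+1 m n).

Lemma size_ovs f m n : m + n < f -> size (ovs f m n) = ovcount m n.
Proof.
move=> lt_mnf; apply/perm_size/uniq_perm; rewrite ?uniq_ovs // => s.
by rewrite !mem_ovs.
Qed.

Lemma ovcount0 n : ovcount 0 n = (n == 0).
Proof. by case: n. Qed.

(** In generating functions,
    (1 - q^(m+1)) C_(m+1) = (1 + q^m) C_m, with 1 in place of 1 + q^m when
    m = 0. *)
Lemma ovcountS m n :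
  ovcount m.+1 n = ovcount m n + (if 0 < m <= n then ovcount m (n - m) else 0)
                   + (if m < n then ovcount m.+1 (n - m.+1) else 0).
Proof.
rewrite {1}/ovcount addSn ovsS !size_cat addnA.
congr (_ + _ + _).
  by case: ifP => // ?; rewrite size_map size_ovs //; lia.
by case: ifP => // ?; rewrite size_map size_ovs //; lia.
Qed.

Lemma ovstep_trans : transitive ovstep.
Proof. move=> [c d] [a b] [e f]; rewrite /ovstep /=; lia. Qed.

(** A first occurrence that may be overlined is recognised locally, by comparison
    with the preceding part, because the parts are sorted. *)
Lemma sorted_ovstepE s :
  sorted ovstep s =
  sorted geq (unzip1 s)
  && all (fun i => nth false (unzip2 s) i
                   ==> (nth 0 (unzip1 s) i \notin take i (unzip1 s)))
         (iota 0 (size s)).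
Proof.
have geq_trans : transitive geq by move=> b a c /=; lia.
elim: s => [|[a b] s IHs] //=.
rewrite !path_sortedE //; last exact: ovstep_trans.
rewrite IHs implybT /= -[1]addn0 iotaDl all_map.
rewrite (@eq_all _ (preim _ _) (predI
  (fun i => nth false (unzip2 s) i ==> (nth 0 (unzip1 s) i != a))
  (fun i => nth false (unzip2 s) i
            ==> (nth 0 (unzip1 s) i \notin take i (unzip1 s))))); last first.
  by move=> i; rewrite [LHS]/= in_cons negb_or /= !add0n; case: (nth false _ i).
rewrite all_predI.
have -> : all (fun i => nth false (unzip2 s) i ==> (nth 0 (unzip1 s) i != a))
              (iota 0 (size s))
        = all (fun y => y.2 ==> (y.1 != a)) s.
  rewrite -[in RHS](mkseq_nth (0, false) s) all_map.
  apply: eq_in_all => i; rewrite mem_iota /= => lt_is.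
  by rewrite !(nth_map (0, false)).
have -> : all (ovstep (a, b)) s =
          all (geq a) (unzip1 s) && all (fun y => y.2 ==> (y.1 != a)) s.
  rewrite all_map -all_predI; apply: eq_all => -[c d].
  by rewrite /ovstep /=; case: d; lia.
by rewrite -!andbA; congr (_ && _); rewrite andbCA.
Qed.

Lemma is_overpartition_bounded n s :
  is_overpartition n s = bounded_ov n.+1 n s.
Proof.
have -> : is_overpartition n s =
  [&& sorted ovstep s, all (fun x => 0 < x.1) s & sumn (unzip1 s) == n].
  rewrite /is_overpartition sorted_ovstepE all_map -!andbA; congr (_ && _).
  by rewrite andbA andbC.
rewrite /bounded_ov; case: s => [|[a b] s] //=.
have [sum_eq | _] := eqP; last by rewrite !andbF.
by have -> : ovstep (n.+1, false) (a, b) by rewrite /ovstep /=; lia.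
Qed.

(** For n < m the part m does not occur, so barring its overline loses
    nothing. *)
Lemma overpE n m : n < m -> overp n = ovcount m n.
Proof.
move=> lt_nm; rewrite /overp cardE -(size_map (@forget_bounds n)).
rewrite /ovcount; apply/perm_size/uniq_perm; last move=> s.
- by rewrite map_inj_uniq ?enum_uniq //; apply: forget_bounds_inj.
- by rewrite uniq_ovs.
have -> : (s \in ovs (m + n).+1 m n) = is_overpartition n s.
  rewrite mem_ovs // is_overpartition_bounded /bounded_ov.
  case: s => [|[a b] s] //=; case: eqP => [sum_eq | _]; last by rewrite !andbF.
  rewrite /ovstep /=; case: (path _ _ _); rewrite ?andbF //; lia.
apply/mapP/idP => [[t]|ov_s]; first by rewrite mem_enum inE => ov_t ->.
have [t t_s] := bounded_overpartition ov_s.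
by exists t; rewrite // mem_enum inE t_s.
Qed.

(** * A finite form of Gauss's identity *)

Section Shanks.
Import GRing.Theory.
Local Open Scope ring_scope.
Variables (R : comRingType) (q : R).

Definition qdist n : R := \prod_(i < n) (1 + q ^+ i.+1).
Definition qpoch n : R := \prod_(i < n) (1 - q ^+ i.+1).

Lemma qdistS n : qdist n.+1 = qdist n * (1 + q ^+ n.+1).
Proof. by rewrite /qdist big_ord_recr. Qed.

Lemma qpochS n : qpoch n.+1 = qpoch n * (1 - q ^+ n.+1).
Proof. by rewrite /qpoch big_ord_recr. Qed.

(** This is the sum over s <= n of c_s (prod_(s < i <= n) (1 - q^i)) x^s, where
    c_0 = 1 and c_s = 2 (-1)^s qdist (s - 1) otherwise.  Shanks evaluates such
    sums at x = q^(n+1), but with x free the telescoping becomes an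
    induction. *)
Fixpoint shanks (n : nat) (x : R) : R :=
  if n is m.+1 then
    (1 - q ^+ n) * shanks m x + 2 * (-1) ^+ n * qdist m * x ^+ n
  else 1.

Lemma shanks_shift n x :
  (1 - x) * shanks n (x * q) =
  (1 + x) * shanks n x + 2 * (-1) ^+ n.+1 * qdist n * x ^+ n.+1.
Proof.
elim: n => [|n IHn] /=; first by rewrite /qdist big_ord0; ring.
rewrite mulrDr mulrCA IHn exprMn qdistS.
rewrite !exprS; ring.
Qed.

(** Passing from n to n.+1 replaces the evaluation point x = q^(n+1) by x q, so
    [shanks_shift] supplies the next square, q^((n+1)^2) being x^(n+1). *)
Lemma shanks_gauss n :
  qdist n * (1 + 2 * \sum_(i < n) (-1) ^+ i.+1 * q ^+ (i.+1 ^ 2)) =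
  shanks n (q ^+ n.+1).
Proof.
elim: n => [|n IHn]; first by rewrite /qdist !big_ord0 /=; ring.
rewrite [RHS]/= [q ^+ n.+2]exprSr shanks_shift -IHn.
rewrite qdistS big_ord_recr /=.
have -> : q ^+ (n.+1 ^ 2) = q ^+ n.+1 ^+ n.+1 by rewrite -exprM mulnn.
have -> : (q ^+ n.+1 * q) ^+ n.+1 = q ^+ n.+1 ^+ n.+1 * q ^+ n.+1 by rewrite exprMn.
set Q := q ^+ n.+1 ^+ n.+1; rewrite !exprS; ring.
Qed.

Lemma shanks_mod n x : exists r, shanks n x = qpoch n + x * r.
Proof.
elim: n => [|n [r IHn]].
  by exists 0; rewrite /qpoch big_ord0 /=; ring.
exists ((1 - q ^+ n.+1) * r + 2 * (-1) ^+ n.+1 * qdist n * x ^+ n).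
rewrite /= IHn qpochS !exprS; ring.
Qed.

Lemma gauss_truncated n : exists r,
  qdist n * (1 + 2 * \sum_(i < n) (-1) ^+ i.+1 * q ^+ (i.+1 ^ 2)) =
  qpoch n + q ^+ n.+1 * r.
Proof. by rewrite shanks_gauss; apply: shanks_mod. Qed.

End Shanks.

(** * The generating function of overpartitions modulo a power of q *)

Section Series.
Import GRing.Theory.
Local Open Scope ring_scope.

(** Congruence modulo X^N. *)
Definition eqX (N : nat) (p q : {poly int}) : Prop :=
  forall i, (i < N)%N -> p`_i = q`_i.

Lemma eqX_mull N r p q : eqX N p q -> eqX N (r * p) (r * q).
Proof.
move=> pq i lt_iN; rewrite !coefM; apply: eq_bigr => j _.
by rewrite pq //; lia.
Qed.

Lemma eqX_trans N q p r : eqX N p q -> eqX N q r -> eqX N p r.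
Proof. by move=> pq qr i lt_iN; rewrite pq // qr. Qed.

Lemma eqX_sym N p q : eqX N p q -> eqX N q p.
Proof. by move=> pq i lt_iN; rewrite pq. Qed.

Lemma eqX_addXn N p r : eqX N (p + 'X^N * r) p.
Proof. by move=> i lt_iN; rewrite coefD coefXnM lt_iN addr0. Qed.

Lemma eqX_cancel N (d p q : {poly int}) :
  d`_0 = 1 -> eqX N (d * p) (d * q) -> eqX N p q.
Proof.
move=> d0 dpq; elim/ltn_ind => i IHi lt_iN.
have := dpq i lt_iN; rewrite !coefM !big_ord_recl /= d0 !mul1r subn0.
rewrite [X in _ + X = _](eq_bigr
  (fun j : 'I_i => d`_(bump 0 j) * q`_(i - bump 0 j))); first exact: addIr.
by move=> j _; rewrite IHi // /bump /=; have := ltn_ord j; lia.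
Qed.

Definition ovseries (N m : nat) : {poly int} :=
  \poly_(i < N) (ovcount m i)%:Z.

Lemma ovseriesS N m :
  eqX N ((1 - 'X^(m.+1)) * ovseries N m.+1)
        ((1 + (0 < m)%:R * 'X^m) * ovseries N m).
Proof.
move=> i lt_iN; rewrite mulrBl mulrDl !mul1r coefB coefD coefXnM.
have -> : ((0 < m)%:R * 'X^m * ovseries N m)`_i =
          if (0 < m <= i)%N then (ovcount m (i - m))%:Z else 0.
  case: m => [|m] /=; first by rewrite !mul0r coef0.
  rewrite mul1r coefXnM ltnNge; case: leqP => //= le_mi.
  by rewrite coef_poly; case: ifP => //; lia.
rewrite !coef_poly lt_iN (leq_ltn_trans (leq_subr _ _) lt_iN) ovcountS.
by case: ifP; case: ifP; case: ifP; lia.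
Qed.

Lemma ovseriesE N m : eqX N (qpoch 'X m.+1 * ovseries N m.+1) (qdist 'X m).
Proof.
elim: m => [|m IHm].
  rewrite /qpoch big_ord_recl big_ord0 mulr1.
  apply: (eqX_trans (@ovseriesS N 0)) => i lt_iN.
  by rewrite mul0r addr0 mul1r coef_poly lt_iN ovcount0 /qdist big_ord0 coef1; case: eqP.
rewrite qpochS -mulrA.
apply: (eqX_trans (eqX_mull _ (@ovseriesS N m.+1))).
rewrite mul1r mulrCA qdistS [X in eqX _ _ X]mulrC; exact: eqX_mull.
Qed.

Definition theta (n : nat) : {poly int} :=
  \sum_(i < n) (-1) ^+ i.+1 * 'X^(i.+1 ^ 2).

Lemma qdist_coef0 n : (qdist ('X : {poly int}) n)`_0 = 1.
Proof.
elim: n => [|n IHn]; first by rewrite /qdist big_ord0 coef1.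
by rewrite qdistS mulrDr mulr1 coefD mulrC coefXnM addr0.
Qed.

Definition ovgen (n : nat) : {poly int} := \poly_(i < n.+1) (overp i)%:Z.

Lemma ovgen_theta n : eqX n.+1 ((1 + 2 * theta n) * ovgen n) 1.
Proof.
have [r gauss] := gauss_truncated ('X : {poly int}) n.
have ->: ovgen n = ovseries n.+1 n.+1.
  apply/polyP => i; rewrite !coef_poly; case: ltnP => // ?.
  by rewrite (@overpE _ n.+1).
apply: (@eqX_cancel _ (qdist 'X n)); first exact: qdist_coef0.
rewrite mulrA gauss mulr1 mulrC.
apply: (eqX_trans (eqX_mull _ (@eqX_addXn _ _ _))); rewrite mulrC.
apply: eqX_trans (@ovseriesE n.+1 n); apply: eqX_sym.
rewrite qpochS mulrBr mulr1 mulrBl.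
set p := qpoch _ n; set q := ovseries _ _.
have -> : p * q - p * 'X^(n.+1) * q = p * q + 'X^(n.+1) * (- (p * q)) by ring.
exact: eqX_addXn.
Qed.

(** With y = - 2 theta and A the generating function, A (1 - y) = 1, so
    A = sum_(j < J) y^j + y^J A. *)
Lemma overp_theta n J : exists z,
  (overp n)%:Z = \sum_(j < J) (-2) ^+ j * (theta n ^+ j)`_n + 2 ^+ J * z.
Proof.
pose y : {poly int} := - 2 * theta n.
exists ((-1) ^+ J * (theta n ^+ J * ovgen n)`_n).
have coefC c (p : {poly int}) : ((-2) ^+ c * p)`_n = (-2) ^+ c * p`_n.
  by rewrite -polyC_natr -polyCN -polyC_exp coefCM.
have -> : (overp n)%:Z = (ovgen n)`_n by rewrite coef_poly ltnSn.
have ovgenE : ovgen n = (\sum_(j < J) y ^+ j) * ((1 + 2 * theta n) * ovgen n)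
                        + y ^+ J * ovgen n.
  have := subrX1 y J; set S := \sum_(_ < _) _ => yJ.
  have -> : y ^+ J = 1 + (y - 1) * S by rewrite -yJ; ring.
  by rewrite /y; ring.
rewrite [in LHS]ovgenE.
rewrite coefD (eqX_mull _ (@ovgen_theta n)) // mulr1 coef_sum.
congr (_ + _); first by apply: eq_bigr => j _; rewrite exprMn coefC.
rewrite exprMn -mulrA coefC.
have -> : (-2 : int) ^+ J = 2 ^+ J * (-1) ^+ J by rewrite -exprMn mulrN1.
by rewrite -mulrA.
Qed.

End Series.

(** * Numbers not represented by some quadratic forms *)

(** For each quadratic form used here, a value divisible by 4 is 4 times
    another value of the form. *)
Lemma descent (Q : nat -> Prop) (d r : nat) :
  (forall n, Q (4 * n) -> Q n) -> (forall m, ~ Q (d * m + r)) ->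
  forall k m, ~ Q (4 ^ k * (d * m + r)).
Proof.
move=> Q4 Qr k m; elim: k => [|k IHk]; first by rewrite mul1n.
by rewrite expnS -mulnA => /Q4.
Qed.

(** Splitting squares this way gives the residues modulo 8 and exposes the
    halved variables needed for the descent. *)
Lemma sqr_cases a :
  (exists2 u, a = 2 * u & a ^ 2 = 4 * u ^ 2) \/ a ^ 2 %% 8 = 1.
Proof.
case: (boolP (odd a)) => odd_a; [right | left].
  have : odd (a %% 8) by lia.
  rewrite -modnXm; move: (ltn_pmod a (isT : 0 < 8)); move: (a %% 8) => r.
  by do 8?[case: r => [|r] //].
by exists a./2; nia.
Qed.

Lemma sqr_mod9 a : a ^ 2 %% 9 \in [:: 0; 1; 4; 7].
Proof.
rewrite -modnXm; move: (ltn_pmod a (isT : 0 < 9)); move: (a %% 9) => r.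
by do 9?[case: r => [|r] //].
Qed.

Definition sq3 n := exists a b c, n = a ^ 2 + b ^ 2 + c ^ 2.
Definition sq1_2 n := exists a b, n = a ^ 2 + 2 * b ^ 2.
Definition sq2 n := exists a b, n = a ^ 2 + b ^ 2.

Lemma sq3_quarter n : sq3 (4 * n) -> sq3 n.
Proof.
move=> [a [b [c]]].
case: (sqr_cases a) => [[u _ ->]|u1]; case: (sqr_cases b) => [[v _ ->]|v1];
case: (sqr_cases c) => [[w _ ->]|w1]; try lia.
by move=> ?; exists u, v, w; lia.
Qed.

Lemma sq3_8m7 k m : ~ sq3 (4 ^ k * (8 * m + 7)).
Proof.
apply: descent; first exact: sq3_quarter.
move=> {}m [a [b [c]]].
have ev u : 4 * u ^ 2 = 0 %[mod 8] \/ 4 * u ^ 2 = 4 %[mod 8].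
  by case: (sqr_cases u) => [[x _ ->]|x1]; lia.
case: (sqr_cases a) => [[u _ ->]|u1]; case: (sqr_cases b) => [[v _ ->]|v1];
case: (sqr_cases c) => [[w _ ->]|w1]; 
 try have := ev u; try have := ev v; try have := ev w; lia.
Qed.

Lemma sq1_2_quarter n : sq1_2 (4 * n) -> sq1_2 n.
Proof.
move=> [a [b]].
case: (sqr_cases a) => [[u _ ->]|u1]; case: (sqr_cases b) => [[v _ ->]|v1]; try lia.
by move=> ?; exists u, v; lia.
Qed.

Lemma sq1_2_8m5 k m : ~ sq1_2 (4 ^ k * (8 * m + 5)).
Proof.
apply: descent; first exact: sq1_2_quarter.
move=> {}m [a [b]].
by case: (sqr_cases a) => [[u _ ->]|u1]; case: (sqr_cases b) => [[v _ ->]|v1]; lia.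
Qed.

Lemma sq1_2_16m14 k m : ~ sq1_2 (4 ^ k * (16 * m + 14)).
Proof.
apply: descent; first exact: sq1_2_quarter.
move=> {}m [a [b]].
case: (sqr_cases a) => [[u _ ->]|u1]; case: (sqr_cases b) => [[v _ ->]|v1]; try lia;
  case: (sqr_cases u) => [[w _ ->]|w1]; lia.
Qed.

Lemma sq2_16m14 k m : ~ sq2 (4 ^ k * (16 * m + 14)).
Proof.
apply: descent => [n|{}m] [a [b]].
  case: (sqr_cases a) => [[u _ ->]|u1]; case: (sqr_cases b) => [[v _ ->]|v1]; try lia.
  by move=> ?; exists u, v; lia.
by case: (sqr_cases a) => [[u _ ->]|u1]; case: (sqr_cases b) => [[v _ ->]|v1]; lia.
Qed.

Lemma mod9_72m69 k m : 4 ^ k * (72 * m + 69) %% 9 = 6.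
Proof. by elim: k => [|k IHk]; rewrite ?expnS -?mulnA; lia. Qed.

Lemma sq2_mod9 n : n %% 9 = 6 -> ~ sq2 n.
Proof.
move=> n6 [a [b def_n]]; move: (sqr_mod9 a) (sqr_mod9 b); rewrite !inE; lia.
Qed.

(** 2 (a^2 + b^2) = (a + b)^2 + (a - b)^2. *)
Lemma sq2_double a b : sq2 (2 * (a ^ 2 + b ^ 2)).
Proof.
wlog le_ba: a b / b <= a.
  by move=> H; case: (leqP b a) => [/H //|/ltnW/H]; rewrite addnC.
by exists (a + b), (a - b); nia.
Qed.

(** * Sums of three squares and a reflection *)

Section Refl.
Import GRing.Theory Num.Theory.
Local Open Scope ring_scope.

(** These are the values of x^2 + y^2 + z^2 on the plane x + y + z = 0, which the
    reflection fixes pointwise. *)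
Definition norm_form2 (n : nat) : Prop :=
  exists x y : int, n%:Z = 2 * (x ^+ 2 + x * y + y ^+ 2).

(** If x^2 + x y + y^2 is even then x and y are both even, so the 2-adic valuation
    of a nonzero value of 2 (x^2 + x y + y^2) is odd. *)
Lemma norm_form2_odd k m : ~ norm_form2 (4 ^ k * (2 * m + 1)).
Proof.
apply: descent => [n|{}m] [x [y def_n]]; last lia.
have [u [e [x_eq e01]]] : exists u e : int, x = 2 * u + e /\ (e = 0 \/ e = 1).
  by exists (x %/ 2)%Z, (x %% 2)%Z; lia.
have [v [f [y_eq f01]]] : exists u e : int, y = 2 * u + e /\ (e = 0 \/ e = 1).
  by exists (y %/ 2)%Z, (y %% 2)%Z; lia.
exists u, v; move: def_n; rewrite x_eq y_eq !expr2.
by case: e01 f01 => -> [] ->; lia.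
Qed.

Definition mean3 (x y z : int) : int := ((x + y + z) %/ 3)%Z.

(** Writing x = 3 u + 1 and so on, the sum of the squares is
    6 (u + v + w) + 3 modulo 9; being 6, it forces u + v + w = 2 modulo 3, and
    the mean of x, y, z is u + v + w + 1. *)
Lemma mean3_spec (n : nat) (x y z : int) :
  (n %% 9 = 6)%N -> n%:Z = x ^+ 2 + y ^+ 2 + z ^+ 2 ->
  (x %% 3)%Z = 1 -> (y %% 3)%Z = 1 -> (z %% 3)%Z = 1 ->
  x + y + z = 3 * mean3 x y z /\ (mean3 x y z %% 3)%Z = 0.
Proof.
move=> n6 def_n x1 y1 z1; rewrite /mean3.
have decomp t : (t %% 3)%Z = 1 -> exists u, t = 3 * u + 1.
  by move=> t1; exists (t %/ 3)%Z; lia.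
have [[u xE] [v yE] [w zE]] := And3 (decomp x x1) (decomp y y1) (decomp z z1).
have sumE : x + y + z = 3 * (u + v + w + 1) by rewrite xE yE zE; ring.
rewrite sumE mulKz //; split=> //.
move: def_n; have -> : x ^+ 2 + y ^+ 2 + z ^+ 2 =
    9 * (u ^+ 2 + v ^+ 2 + w ^+ 2) + 6 * (u + v + w) + 3.
  by rewrite xE yE zE; ring.
move: (u ^+ 2 + _ + _) (u + v + w) n6 => p t; clear.
move: n => n n6 def_n.
have : ((9 * p + 6 * t + 3) %% 9)%Z = 6 by rewrite -def_n; lia.
by clear; lia.
Qed.

(** The sign that makes an integer prime to 3 congruent to 1 modulo 3. *)
Definition signed3 (a : nat) : int := if (a %% 3 == 1)%N then a%:Z else - a%:Z.

Lemma signed3_mod a : (a %% 3 != 0)%N -> (signed3 a %% 3)%Z = 1.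
Proof. by rewrite /signed3; case: ifP; lia. Qed.

Lemma signed3_sqr a : signed3 a ^+ 2 = (a ^ 2)%N%:Z.
Proof. by rewrite /signed3; case: ifP => _; rewrite ?sqrrN expr2 -mulnn. Qed.

Lemma signed3_abs x : (x %% 3)%Z = 1 -> signed3 `|x|%N = x.
Proof. by rewrite /signed3; case: ifP; lia. Qed.

Lemma abs_signed3 a : `|signed3 a|%N = a.
Proof. by rewrite /signed3; case: ifP; lia. Qed.

Definition triple : Type := (nat * nat * nat)%type.

Definition three_squares (n : nat) (t : triple) : bool :=
  [&& (0 < t.1.1)%N, (0 < t.1.2)%N, (0 < t.2)%N
    & (t.1.1 ^ 2 + t.1.2 ^ 2 + t.2 ^ 2 == n)%N].

Definition mean (t : triple) : int :=
  mean3 (signed3 t.1.1) (signed3 t.1.2) (signed3 t.2).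

(** Reflection in the plane orthogonal to (1, 1, 1), read on positive entries
    through the signs of [signed3]. *)
Definition mirror (t : triple) : triple :=
  (`|(signed3 t.1.1 - 2 * mean t)%R|%N, `|(signed3 t.1.2 - 2 * mean t)%R|%N,
   `|(signed3 t.2 - 2 * mean t)%R|%N).

Definition swap (t : triple) : triple := (t.1.2, t.1.1, t.2).

Lemma mirror_swap t : mirror (swap t) = swap (mirror t).
Proof.
have mean_swap : mean (swap t) = mean t.
  by rewrite /mean /mean3 /= [signed3 _ + signed3 _]addrC.
by rewrite /mirror mean_swap.
Qed.

Section Solutions.
Variables (n : nat) (t : triple).
Hypotheses (n6 : (n %% 9 = 6)%N) (sol : three_squares n t).

Lemma three_squares_mod3 :
  [/\ (signed3 t.1.1 %% 3)%Z = 1, (signed3 t.1.2 %% 3)%Z = 1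
    & (signed3 t.2 %% 3)%Z = 1].
Proof.
have [_ _ _ /eqP def_n] := and4P sol.
have sqr_mod3 a : (a %% 3 = 0 -> a ^ 2 %% 9 = 0)%N.
  by move=> a0; have -> : a = (3 * (a %/ 3))%N; [lia | rewrite expnMn; lia].
move: (sqr_mod9 t.1.1) (sqr_mod9 t.1.2) (sqr_mod9 t.2); rewrite !inE.
by split; apply/signed3_mod/eqP => /sqr_mod3; lia.
Qed.

Lemma three_squares_mean :
  signed3 t.1.1 + signed3 t.1.2 + signed3 t.2 = 3 * mean t
  /\ (mean t %% 3)%Z = 0.
Proof.
have [_ _ _ /eqP def_n] := and4P sol; have [x1 y1 z1] := three_squares_mod3.
by apply: (mean3_spec n6) => //; rewrite !signed3_sqr -def_n !PoszD.
Qed.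

(** The mean is divisible by 3, so the reflected entries are again 1 modulo 3 and
    taking absolute values loses no sign. *)
Lemma signed3_mirror :
  [/\ signed3 (mirror t).1.1 = signed3 t.1.1 - 2 * mean t,
      signed3 (mirror t).1.2 = signed3 t.1.2 - 2 * mean t
    & signed3 (mirror t).2 = signed3 t.2 - 2 * mean t].
Proof.
have [x1 y1 z1] := three_squares_mod3; have [_ m0] := three_squares_mean.
by split; apply: signed3_abs; lia.
Qed.

Lemma mean_mirror : mean (mirror t) = - mean t.
Proof.
have [xE yE zE] := signed3_mirror; have [sumE _] := three_squares_mean.
by rewrite [LHS]/mean xE yE zE /mean3; lia.
Qed.

Lemma three_squares_mirror : three_squares n (mirror t).
Proof.
have [x1 y1 z1] := three_squares_mod3; have [sumE m0] := three_squares_mean.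
have [xE yE zE] := signed3_mirror.
have [_ _ _ /eqP def_n] := and4P sol.
apply/and4P; split; try (rewrite /mirror /=; lia).
apply/eqP; suff : ((mirror t).1.1 ^ 2 + (mirror t).1.2 ^ 2 + (mirror t).2 ^ 2)%N%:Z
               = n%:Z by case.
rewrite -def_n !PoszD -!signed3_sqr xE yE zE.
have -> : signed3 t.2 = 3 * mean t - signed3 t.1.1 - signed3 t.1.2.
  by rewrite -sumE; ring.
by ring.
Qed.

Lemma mirrorK : mirror (mirror t) = t.
Proof.
have [xE yE zE] := signed3_mirror.
rewrite {1}/mirror mean_mirror xE yE zE mulrN opprK !subrK !abs_signed3.
by case: (t) => -[].
Qed.

(** A fixed last entry forces the mean to vanish, so the signed solution lies in
    the plane x + y + z = 0. *)
Lemma mirror_neq : ~ norm_form2 n -> (mirror t).2 != t.2.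
Proof.
move=> not_norm; apply/eqP => eq_c; apply: not_norm.
have [_ _ _ /eqP def_n] := and4P sol.
have [xE yE zE] := signed3_mirror; have [sumE _] := three_squares_mean.
have m0 : mean t = 0 by move: zE; rewrite eq_c; lia.
exists (signed3 t.1.1), (signed3 t.1.2).
rewrite -def_n !PoszD -!signed3_sqr.
have -> : signed3 t.2 = - (signed3 t.1.1 + signed3 t.1.2) by lia.
by ring.
Qed.

End Solutions.

End Refl.

Lemma involution_even (T : eqType) (s : seq T) (f : T -> T) :
  uniq s -> {in s, forall x, f x \in s} -> {in s, forall x, f (f x) = x} ->
  {in s, forall x, f x != x} -> ~~ odd (size s).
Proof.
have [m] := ubnP (size s); elim: m s => // m IHm [|x s] //= lt_sm.
move=> /andP[xs uniq_s] f_in fK f_neq.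
have fx_s : f x \in s.
  by have := f_in x (mem_head _ _); rewrite in_cons (negbTE (f_neq _ (mem_head _ _))).
have def_size := perm_size (perm_to_rem fx_s).
have sub y : y \in rem (f x) s -> y \in x :: s.
  by move=> /mem_rem; rewrite in_cons orbC => ->.
rewrite def_size /= negbK; apply: IHm.
- by move: lt_sm; rewrite def_size /=; lia.
- exact: rem_uniq.
- move=> y y_r; have := f_in y (sub y y_r); move: y_r.
  rewrite !mem_rem_uniq // !inE => /andP[y_fx y_s] /orP[/eqP fy_x|->].
    by move: y_fx; rewrite -fy_x fK ?eqxx // inE y_s orbT.
  rewrite andbT; apply/eqP => /(congr1 f); rewrite !fK ?inE ?eqxx ?y_s ?orbT //.
  by move=> y_x; rewrite -y_x y_s in xs.
- by move=> y /sub; apply: fK.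
- by move=> y /sub; apply: f_neq.
Qed.

Lemma three_squares_swap n t : three_squares n (swap t) = three_squares n t.
Proof. by rewrite /three_squares /= andbCA [_ ^ 2 + _ ^ 2]addnC. Qed.

(** The first two entries always differ, since n is not of the form
    a^2 + 2 b^2; so exchanging them halves the set of solutions to those with
    a < b.  On these, reflecting and then sorting the first two entries is an
    involution, without fixed points because it moves the last entry. *)
Lemma three_squares_dvd4 n (s : seq triple) :
  uniq s -> (forall t, (t \in s) = three_squares n t) ->
  n %% 9 = 6 -> ~ norm_form2 n -> ~ sq1_2 n -> 4 %| size s.
Proof.
move=> uniq_s mem_s n6 not_norm not_sq.
pose lt (t : triple) := t.1.1 < t.1.2; pose gt (t : triple) := t.1.2 < t.1.1.
have -> : size s = size (filter lt s) + size (filter gt s).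
  rewrite -(count_predC lt s) !size_filter; congr (_ + _).
  apply: eq_in_count => t; rewrite mem_s => /and4P[_ _ _ /eqP def_n].
  rewrite /gt /lt /= -leqNgt ltn_neqAle.
  suff -> : t.1.2 != t.1.1 by [].
  apply/eqP => eq_ab; apply: not_sq; exists t.2, t.1.1.
  by rewrite -def_n eq_ab mul2n -addnn addnC.
have -> : size (filter gt s) = size (filter lt s).
  rewrite -(size_map swap); apply/perm_size/uniq_perm.
  - rewrite map_inj_uniq ?filter_uniq //.
    by move=> [[a b] c] [[d e] f] [-> -> ->].
  - exact: filter_uniq.
  have swapK t : swap (swap t) = t by case: t => -[].
  move=> t; rewrite -[t in LHS]swapK mem_map; last exact: (can_inj swapK).
  by rewrite !mem_filter !mem_s three_squares_swap.
rewrite addnn -muln2 (@dvdn_pmul2r 2 2) //.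
pose f t := if lt (mirror t) then mirror t else swap (mirror t).
have mem_lt t : (t \in filter lt s) = lt t && three_squares n t.
  by rewrite mem_filter mem_s.
rewrite dvdn2; apply: (involution_even (f := f)).
- exact: filter_uniq.
- move=> t; rewrite !mem_lt => /andP[_ sol_t]; rewrite /f.
  have sol_r := three_squares_mirror n6 sol_t.
  case: ifP => [-> // | /negbT lt_r]; rewrite three_squares_swap sol_r andbT.
  move: lt_r; rewrite /lt -leqNgt leq_eqVlt => /orP[/eqP eq_ab | //].
  have [_ _ _ /eqP def_n] := and4P sol_r.
  by case: not_sq; exists (mirror t).2, (mirror t).1.1; rewrite -def_n eq_ab mul2n -addnn addnC.
- move=> t; rewrite mem_lt => /andP[lt_t sol_t]; rewrite {2}/f.
  case: ifP => _; rewrite /f ?mirror_swap (mirrorK n6 sol_t) ?lt_t //.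
  have -> : lt (swap t) = false by move: lt_t; rewrite /lt /=; lia.
  by case: (t) => -[].
- move=> t; rewrite mem_lt => /andP[_ sol_t].
  have := mirror_neq n6 sol_t not_norm; apply: contraNneq => {2}<-.
  by rewrite /f; case: ifP.
Qed.

(** * Powers of theta and the congruences *)

Section Powers.
Import GRing.Theory.
Local Open Scope ring_scope.

Lemma sqr_sum_mod2 (R : comRingType) n (x : 'I_n -> R) :
  exists w, (\sum_i x i) ^+ 2 = \sum_i x i ^+ 2 + 2 * w.
Proof.
elim: n x => [|n IHn] x; first by exists 0; rewrite !big_ord0; ring.
have [w IHx] := IHn (fun i => x (lift ord0 i)).
exists (w + x ord0 * \sum_(i < n) x (lift ord0 i)).
by rewrite !big_ord_recl sqrrD IHx mulr_natl; ring.
Qed.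

Definition sqseries (d n : nat) : {poly int} := \sum_(i < n) 'X^(d * i.+1 ^ 2).

(** The signs of theta disappear in the sum of the squares of its terms. *)
Lemma theta_sqr n : exists w, theta n ^+ 2 = sqseries 2 n + 2 * w.
Proof.
have [w eq_w] := sqr_sum_mod2
  (fun i : 'I_n => (-1) ^+ i.+1 * 'X^(i.+1 ^ 2) : {poly int}).
exists w; rewrite [LHS]eq_w; congr (_ + _); apply: eq_bigr => i _.
by rewrite exprMn -exprM mulnC exprM sqrrN !expr1n mul1r -exprM mulnC.
Qed.

Lemma sqseries_sqr d n : exists w, sqseries d n ^+ 2 = sqseries (2 * d) n + 2 * w.
Proof.
have [w eq_w] := sqr_sum_mod2 (fun i : 'I_n => 'X^(d * i.+1 ^ 2) : {poly int}).
exists w; rewrite [LHS]eq_w; congr (_ + _); apply: eq_bigr => i _.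
by rewrite -exprM mulnC mulnA.
Qed.

Lemma coefM_neq0 (p q : {poly int}) n : (p * q)`_n != 0 ->
  exists i j, [/\ n = (i + j)%N, p`_i != 0 & q`_j != 0].
Proof.
rewrite coefM; have [/existsP[i] | noex] :=
  boolP [exists i : 'I_n.+1, (p`_i != 0) && (q`_(n - i) != 0)].
  by case/andP=> *; exists i, (n - i)%N; split=> //; have := ltn_ord i; lia.
case/eqP; apply: big1 => i _; move: noex; rewrite negb_exists => /forallP/(_ i).
by rewrite negb_and !negbK => /orP[] /eqP ->; rewrite ?mul0r ?mulr0.
Qed.

Lemma coef_sumXn_neq0 n (c : nat -> {poly int}) (f : nat -> nat) m :
  (forall i, exists b, c i = b%:P) ->
  (\sum_(i < n) c i * 'X^(f i))`_m != 0 -> exists i, m = f i.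
Proof.
move=> c_const; rewrite coef_sum; have [/existsP[i /eqP->] | noex] :=
  boolP [exists i : 'I_n, m == f i]; first by exists i.
case/eqP; apply: big1 => i _; have [b ->] := c_const i.
move: noex; rewrite negb_exists => /forallP/(_ i)/negbTE m_fi.
by rewrite coefCM coefXn m_fi mulr0.
Qed.

Lemma theta_neq0 n m : (theta n)`_m != 0 -> exists a, m = (a ^ 2)%N.
Proof.
move=> /(@coef_sumXn_neq0 n (fun i => (-1) ^+ i.+1) (fun i => i.+1 ^ 2)%N).
case=> [i | i m_i]; last by exists i.+1.
by exists ((-1) ^+ i.+1); rewrite polyC_exp polyCN.
Qed.

Lemma sqseries_neq0 d n m : (sqseries d n)`_m != 0 -> exists a, m = (d * a ^ 2)%N.
Proof.
rewrite /sqseries; under eq_bigr => i _ do rewrite -['X^_]mul1r.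
move=> /(@coef_sumXn_neq0 n (fun i => 1) (fun i => d * i.+1 ^ 2)%N).
case=> [i | i m_i]; last by exists i.+1.
by exists 1.
Qed.

Lemma theta2_eq0 n m : ~ sq2 m -> (theta n ^+ 2)`_m = 0.
Proof.
move=> not_sq; apply/eqP; apply/negPn/negP => /coefM_neq0[i [j [m_ij]]].
move=> /theta_neq0[a i_a] /theta_neq0[b j_b].
by apply: not_sq; exists a, b; rewrite m_ij i_a j_b.
Qed.

Lemma theta1_eq0 n m : ~ sq2 m -> (theta n)`_m = 0.
Proof.
move=> not_sq; apply/eqP; apply/negPn/negP => /theta_neq0[a m_a].
by apply: not_sq; exists a, 0%N; rewrite addn0.
Qed.

Lemma theta3_eq0 n m : ~ sq3 m -> (theta n ^+ 3)`_m = 0.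
Proof.
move=> not_sq; apply/eqP; apply/negPn/negP; rewrite exprS.
move=> /coefM_neq0[i [j [m_ij /theta_neq0[a i_a] /coefM_neq0[k [l [j_kl]]]]]].
move=> /theta_neq0[b k_b] /theta_neq0[c l_c].
by apply: not_sq; exists a, b, c; rewrite m_ij j_kl i_a k_b l_c addnA.
Qed.

Lemma coefC_natM c (p : {poly int}) n : (c%:R * p)`_n = c%:R * p`_n.
Proof. by rewrite -polyC_natr coefCM. Qed.

(** theta^3 = theta sum_a q^(2 a^2) modulo 2. *)
Lemma theta3_mod2 n m : ~ sq1_2 m -> exists z, (theta n ^+ 3)`_m = 2 * z.
Proof.
move=> not_sq; have [w thetaE] := theta_sqr n.
exists (theta n * w)`_m; rewrite exprS thetaE mulrDr mulrCA coefD coefC_natM.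
have -> : (theta n * sqseries 2 n)`_m = 0; last by rewrite add0r.
apply/eqP; apply/negPn/negP => /coefM_neq0[i [j [m_ij /theta_neq0[a i_a]]]].
move=> /sqseries_neq0[b j_b].
by apply: not_sq; exists a, b; rewrite m_ij i_a j_b.
Qed.

(** A congruence modulo 2 squares to a congruence modulo 4, and the square of
    sum_a q^(2 a^2) has its exponents of the form 2 a^2 + 2 b^2. *)
Lemma theta4_mod4 n m : ~ sq2 m -> exists z, (theta n ^+ 4)`_m = 4 * z.
Proof.
move=> not_sq; have [w thetaE] := theta_sqr n.
exists (sqseries 2 n * w + w ^+ 2)`_m.
have -> : theta n ^+ 4 = sqseries 2 n ^+ 2 + 4 * (sqseries 2 n * w + w ^+ 2).
  by rewrite (exprM _ 2 2) thetaE; ring.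
rewrite coefD coefC_natM.
have -> : (sqseries 2 n ^+ 2)`_m = 0; last by rewrite add0r.
apply/eqP; apply/negPn/negP => /coefM_neq0[i [j [m_ij]]].
move=> /sqseries_neq0[a i_a] /sqseries_neq0[b j_b].
by apply: not_sq; rewrite m_ij i_a j_b -mulnDr; apply: sq2_double.
Qed.

(** theta^5 = theta sum_a q^(4 a^2) modulo 2. *)
Lemma theta5_mod2 n m : ~ sq2 m -> exists z, (theta n ^+ 5)`_m = 2 * z.
Proof.
move=> not_sq; have [w thetaE] := theta_sqr n.
have [v sqE] := sqseries_sqr 2 n.
exists (theta n * (v + 2 * (sqseries 2 n * w + w ^+ 2)))`_m.
have -> : theta n ^+ 5 = theta n * sqseries 4 n +
  2 * (theta n * (v + 2 * (sqseries 2 n * w + w ^+ 2))).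
  rewrite exprS (exprM _ 2 2) thetaE.
  have -> : sqseries 4 n = sqseries 2 n ^+ 2 - 2 * v by rewrite sqE addrK.
  by ring.
rewrite coefD coefC_natM.
have -> : (theta n * sqseries 4 n)`_m = 0; last by rewrite add0r.
apply/eqP; apply/negPn/negP => /coefM_neq0[i [j [m_ij /theta_neq0[a i_a]]]].
move=> /sqseries_neq0[b j_b].
by apply: not_sq; exists a, (2 * b)%N; rewrite m_ij i_a j_b expnMn.
Qed.

Definition triples (n : nat) : seq triple :=
  [seq (p, c) | p <- [seq (a, b) | a <- iota 1 n, b <- iota 1 n], c <- iota 1 n].

Definition theta_term (a : nat) : {poly int} := (-1) ^+ a * 'X^(a ^ 2).

Lemma theta_iota n : theta n = \sum_(a <- iota 1 n) theta_term a.
Proof.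
have -> : iota 1 n = index_iota 1 n.+1 by rewrite /index_iota subSS subn0.
by rewrite big_add1 big_mkord.
Qed.

Lemma theta_cube n : theta n ^+ 3 =
  \sum_(t <- triples n) theta_term t.1.1 * theta_term t.1.2 * theta_term t.2.
Proof.
rewrite /triples !big_allpairs /= exprSr expr2 theta_iota big_distrlr /=.
rewrite mulr_suml; apply: eq_bigr => a _; rewrite mulr_suml.
by apply: eq_bigr => b _; rewrite mulr_sumr.
Qed.

Lemma mem_pairs (S T : eqType) (r : seq S) (s : seq T) x :
  (x \in [seq (a, b) | a <- r, b <- s]) = (x.1 \in r) && (x.2 \in s).
Proof.
apply/allpairsP/andP => [[[a b] [a_r b_s ->]] // | [x1 x2]].
by exists x; rewrite -surjective_pairing.
Qed.

Lemma mem_triples n t : (t \in triples n) =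
  [&& (0 < t.1.1 <= n)%N, (0 < t.1.2 <= n)%N & (0 < t.2 <= n)%N].
Proof. by rewrite !mem_pairs !mem_iota !add1n !ltnS -!andbA. Qed.

Lemma uniq_triples n : uniq (triples n).
Proof.
have uniq_pairs (S T : eqType) (r : seq S) (s : seq T) :
    uniq r -> uniq s -> uniq [seq (a, b) | a <- r, b <- s].
  by move=> ur us; apply: allpairs_uniq => // -[a b] [c d].
by rewrite !uniq_pairs ?iota_uniq.
Qed.

(** Since a^2 and a have the same parity, the sign depends only on the
    exponent. *)
Lemma theta_term3 (t : triple) n :
  (theta_term t.1.1 * theta_term t.1.2 * theta_term t.2)`_n =
  (-1) ^+ n * (t.1.1 ^ 2 + t.1.2 ^ 2 + t.2 ^ 2 == n)%N%:R.
Proof.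
case: t => -[a b] c /=.
have -> : theta_term a * theta_term b * theta_term c =
          ((-1) ^+ (a + b + c))%:P * 'X^(a ^ 2 + b ^ 2 + c ^ 2).
  by rewrite polyC_exp polyCN /theta_term !exprD; ring.
rewrite coefCM coefXn eq_sym; case: eqP => [<- | _]; last by rewrite !mulr0.
congr (_ * _); rewrite -[LHS]signr_odd -[RHS]signr_odd.
by rewrite !oddD !oddX.
Qed.

Lemma theta3_count n :
  (theta n ^+ 3)`_n = (-1) ^+ n * (size (filter (three_squares n) (triples n)))%:R.
Proof.
rewrite theta_cube coef_sum size_filter -sum1_count natr_sum mulr_sumr.
rewrite [RHS]big_mkcond; apply: eq_big_seq => t; rewrite mem_triples.
move=> /and3P[/andP[a0 _] /andP[b0 _] /andP[c0 _]].
rewrite theta_term3 /three_squares a0 b0 c0 /=.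
by case: eqP; rewrite ?mulr0 ?mulr1.
Qed.

Lemma theta3_mod4 n : (n %% 9 = 6)%N -> ~ norm_form2 n -> ~ sq1_2 n ->
  exists z, (theta n ^+ 3)`_n = 4 * z.
Proof.
move=> n6 not_norm not_sq; rewrite theta3_count.
have /dvdnP[c ->] : (4 %| size (filter (three_squares n) (triples n)))%N.
  apply: (@three_squares_dvd4 n) => // [|t]; first by rewrite filter_uniq ?uniq_triples.
  rewrite mem_filter mem_triples andb_idr // => /and4P[a0 b0 c0 /eqP <-].
  rewrite a0 b0 c0 /=; nia.
by exists ((-1) ^+ n * c%:R); rewrite natrM; ring.
Qed.

Lemma overp_dvd n d (z : int) : (overp n)%:Z = d%:R * z -> overp n = 0 %[mod d].
Proof.
rewrite natz => eq_z; apply/eqP; rewrite mod0n -/(dvdn d _).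
have := congr1 absz eq_z; rewrite abszM !absz_nat => ->; exact: dvdn_mulr.
Qed.

Lemma theta0_eq0 n m : (0 < m)%N -> (theta n ^+ 0)`_m = 0.
Proof. by rewrite expr0 coef1; case: m. Qed.

Lemma overp_mod16 n : (0 < n)%N -> ~ sq2 n -> ~ sq1_2 n ->
  overp n = 0 %[mod 16].
Proof.
move=> n_gt0 not_sq2 not_sq12; have [y overp_n] := overp_theta n 4.
have [z theta3] := theta3_mod2 n not_sq12.
apply: (@overp_dvd _ _ (y - z)); rewrite overp_n !big_ord_recr big_ord0 /=.
rewrite theta0_eq0 // theta1_eq0 // theta2_eq0 // theta3.
by ring.
Qed.

Lemma overp_mod32 n : (n %% 9 = 6)%N -> ~ norm_form2 n -> ~ sq1_2 n ->
  overp n = 0 %[mod 32].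
Proof.
move=> n6 not_norm not_sq12; have not_sq2 := sq2_mod9 n6.
have n_gt0 : (0 < n)%N by lia.
have [y overp_n] := overp_theta n 5.
have [z theta3] := theta3_mod4 n6 not_norm not_sq12.
have [x theta4] := theta4_mod4 n not_sq2.
apply: (@overp_dvd _ _ (y - z + 2 * x)).
rewrite overp_n !big_ord_recr big_ord0 /=.
rewrite theta0_eq0 // theta1_eq0 // theta2_eq0 // theta3 theta4.
by ring.
Qed.

Lemma overp_mod64 n : (0 < n)%N -> ~ sq3 n -> overp n = 0 %[mod 64].
Proof.
move=> n_gt0 not_sq3.
have not_sq2 : ~ sq2 n.
  by case=> a [b def_n]; apply: not_sq3; exists a, b, 0%N; rewrite addn0.
have [y overp_n] := overp_theta n 6.
have [z theta4] := theta4_mod4 n not_sq2.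
have [x theta5] := theta5_mod2 n not_sq2.
apply: (@overp_dvd _ _ (y + z - x)).
rewrite overp_n !big_ord_recr big_ord0 /=.
rewrite theta0_eq0 // theta1_eq0 // theta2_eq0 // theta3_eq0 // theta4 theta5.
by ring.
Qed.

End Powers.

Unset Implicit Arguments.

Theorem mainTheorem5 (n k : nat) :
  [/\ overp (4 ^ k * (16 * n + 14)) = 0 %[mod 16],
      overp (4 ^ k * (72 * n + 69)) = 0 %[mod 32]
    & overp (4 ^ k * (8 * n + 7)) = 0 %[mod 64]].
Proof.
have pow_gt0 : 0 < 4 ^ k by rewrite expn_gt0.
have eq8 : 72 * n + 69 = 8 * (9 * n + 8) + 5 by lia.
have eq2 : 72 * n + 69 = 2 * (36 * n + 34) + 1 by lia.
split.
- apply: overp_mod16; [by rewrite muln_gt0 pow_gt0; lia | exact: sq2_16m14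
    | exact: sq1_2_16m14].
- apply: overp_mod32; first exact: mod9_72m69.
    by rewrite eq2; apply: norm_form2_odd.
  by rewrite eq8; apply: sq1_2_8m5.
- apply: overp_mod64; last exact: sq3_8m7.
  by rewrite muln_gt0 pow_gt0; lia.
Qed.
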